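(* Let $n\in\mathbb N$, let $Z_1,\dots,Z_n$ be independent with $Z_i\sim N(\mu_i,1)$, $\mu_i\ge0$, let $r_i=\mathbf 1(\mu_i>0)$ and $p_i=1-\Phi(Z_i)$. Let $\alpha,\beta\in(0,1)$. (a) The batch Stouffer test at level $\alpha$, which rejects iff $\sum_{i=1}^n\Phi^{-1}(1-p_i)>\sqrt n\,Z_\alpha$, has power at least $1-\beta$ if and only if $\sum_{i=1}^n r_i\mu_i\ge (Z_\alpha+Z_\beta)n^{1/2}$, where $Z_\gamma=\Phi^{-1}(1-\gamma)$. (b) The martingale Stouffer test at level $\alpha$, which rejects iff there is $k\in\{1,\dots,n\}$ with $\sum_{i=1}^k\Phi^{-1}(1-p_i)\ge C_k^\alpha k^{1/2}$, has power at least $1-\beta$ if there exists $k\in\{1,\dots,n\}$ with $\sum_{i=1}^k r_i\mu_i\ge (C_k^\alpha+C_k^\beta)k^{1/2}$. (c) If $\alpha<1-\beta$, the power of this martingale Stouffer test is less than $1-\beta$ whenever $\sum_{i=1}^k r_i\mu_i\le (C_k^\alpha-C_k^{1-\beta})k^{1/2}$ for all $k\in\{1,\dots,n\}$.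
   Context: $\Phi$ is the standard Gaussian CDF. For $\gamma\in(0,1)$ and $k\ge1$, $C_k^\gamma:=1.7\sqrt{\log\log(2k)+0.72\log\frac{5.2}{\gamma}}$, so that $C_k^\alpha k^{1/2}=1.7\sqrt{k(\log\log(2k)+0.72\log\frac{5.2}{\alpha})}$ is the curved boundary. The power of a test is the probability that it rejects. *)

(* Defs.v *)
From HB Require Import structures.
From mathcomp Require Import all_boot all_order all_algebra.
From mathcomp Require Import all_classical all_reals all_analysis.
Set Implicit Arguments. Unset Strict Implicit. Unset Printing Implicit Defensive.
Import Order.TTheory GRing.Theory Num.Theory.
Local Open Scope classical_set_scope.
Local Open Scope ring_scope.

Section Defs.
Context {R : realType}.

Definition Phi (x : R) : R := fine (normal_prob 0 1 `]-oo, x]).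

(* Phi^{-1}: some x with Phi x = p (unique for p in (0,1)); 0 if none *)
Definition Phi_inv (p : R) : R := xget 0 [set x | Phi x = p].

Definition Zq (g : R) : R := Phi_inv (1 - g).

Definition Ccurv (k : nat) (g : R) : R :=
  (17 / 10) * Num.sqrt (ln (ln (2 * k%:R)) + (72 / 100) * ln ((52 / 10) / g)).
End Defs.

Definition mutually_independent d (T : measurableType d) (R : realType)
  (P : probability T R) (n : nat) (X : 'I_n -> {RV P >-> R}) : Prop :=
  forall (J : {set 'I_n}) (B : 'I_n -> set R),
    (forall i, measurable (B i)) ->
    P [set t | forall i, i \in J -> B i (X i t)] =
    (\prod_(i in J) P (X i @^-1` B i))%E.

(* Main.v *)
Require Import Defs.
From HB Require Import structures.
From mathcomp Require Import all_boot all_order all_algebra.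
From mathcomp Require Import all_classical all_reals all_analysis.
From mathcomp Require Import measurable_realfun.
From mathcomp Require Import ring lra.
Import Order.TTheory GRing.Theory Num.Theory.
Import numFieldNormedType.Exports.
Local Open Scope classical_set_scope.
Local Open Scope ring_scope.

(* The partial sums of the Z_i are Gaussian, which settles the batch test.
   For a Gaussian walk W with unit variances, exp (l W_k - l^2 k / 2) is a
   martingale; stopping it when it reaches a level L and applying Markov's
   inequality bounds by 1/L the probability that it ever reaches L (Ville).
   With k fixed and l = - C_k / sqrt k this is the Gaussian tail bound behind
   the power guarantee of the martingale test.
   For the converse, cut {1, ..., n} into the epochs [2^j, 2^(j+1)).  On an
   epoch the curve k |-> C_k sqrt k lies above a line, which W crosses with
   probability at most ((j+1) log 2)^(-7/5) (g / 5.2)^(1.008); summed over j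
   this stays below g because zeta(7/5) (log 2)^(-7/5) < 5.2^(1.008). *)

(** * Normal laws: integrals against the density, and affine images *)

Section normal_lemmas.
Context {R : realType}.
Implicit Types (m s x a b : R).
Local Notation leb := (@lebesgue_measure R).

(** The Radon-Nikodym derivative of the normal law agrees almost everywhere with [normal_pdf],
    because both have the same integral over every measurable set; change of variables does the
    rest. *)
Lemma ge0_integral_normal_prob m s f : s != 0 ->
  measurable_fun setT f -> (forall x, (0 <= f x)%E) ->
  (\int[normal_prob m s]_x f x = \int[leb]_x (f x * (normal_pdf m s x)%:E))%E.
Proof.
move=> s0 mf f0.
have dom := normal_prob_dominates m s.
rewrite -(Radon_Nikodym_SigmaFinite.change_of_variables dom)//.
apply: ae_eq_integral => //.
- apply: emeasurable_funM => //.
  exact: measurable_int (Radon_Nikodym_SigmaFinite.f_integrable dom).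
- apply: emeasurable_funM => //.
  by apply/measurable_EFinP; exact: measurable_normal_pdf.
- apply: ae_eqe_mul2l => /=.
  apply: integral_ae_eq => //=.
  + exact: Radon_Nikodym_SigmaFinite.f_integrable.
  + by apply/measurable_EFinP; exact: measurable_normal_pdf.
  + by move=> E _ mE; rewrite -Radon_Nikodym_SigmaFinite.f_integral.
Qed.

(** Closed right half-lines are stable under intersection, generate the Borel sets and exhaust the
    line, so uniqueness of measures applies. *)
Lemma probability_eq_half_lines (m1 m2 : probability (measurableTypeR R) R) :
  (forall x : R, m1 `[x, +oo[%classic = m2 `[x, +oo[%classic) ->
  forall A, measurable A -> m1 A = m2 A.
Proof.
move=> m12 A mA.
apply: (@measure_unique _ R (measurableTypeR R) (@RGenCInfty.G R)
  (fun n => `[- n%:R, +oo[%classic)) => //.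
- exact: RGenCInfty.measurableE.
- move=> _ _ [x ->] [y ->]; exists (Num.max x y).
  by apply/seteqP; split=> z /=; rewrite !in_itv/= !andbT ge_max => /andP.
- by move=> n; exists (- n%:R).
- apply/seteqP; split => // x _; exists (Num.trunc `|x|).+1 => //=.
  rewrite in_itv/= andbT lerNl (le_trans (ler_norm _))// normrN.
  exact/ltW/truncnS_gt.
- by move=> _ [x ->]; exact: m12.
- by move=> n; rewrite (le_lt_trans (probability_le1 _ _)) ?ltry.
Qed.

(** The factor [a] is the Jacobian that the substitution in [normal_prob_affine] produces. *)
Lemma normal_pdf_affine m s a b x : s != 0 -> 0 < a ->
  normal_pdf (a * m + b) (a * s) (a * x + b) * a = normal_pdf m s x.
Proof.
move=> s0 a0; have a1 : a != 0 by rewrite gt_eqF.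
rewrite !normal_pdfE ?mulf_neq0//.
rewrite /normal_fun /normal_peak.
have -> : - (a * x + b - (a * m + b)) ^+ 2 / ((a * s) ^+ 2 *+ 2) =
   - (x - m) ^+ 2 / (s ^+ 2 *+ 2).
  by field; rewrite s0.
rewrite mulrAC; congr (_ * _).
rewrite exprMn -mulrA -mulrnAr sqrtrM ?sqr_ge0// sqrtr_sqr gtr0_norm//.
by rewrite invfM mulrAC mulVf ?mul1r. Qed.

(** Only half-lines have to be compared, and there the increasing substitution [z |-> a * z + b]
    carries one integral of the density to the other. *)
Lemma normal_prob_affine m s a b (A : set R) : s != 0 -> 0 < a -> measurable A ->
  normal_prob m s ((fun z => a * z + b) @^-1` A) = normal_prob (a * m + b) (a * s) A.
Proof.
move=> s0 a0.
have mF : @measurable_fun _ _ (measurableTypeR R) (measurableTypeR R) setT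
    (fun z => a * z + b).
  by apply: measurable_funD => //; apply: measurable_funM.
pose F' := @mfun_Sub _ _ (measurableTypeR R) (measurableTypeR R) _ (mem_set mF).
apply: (probability_eq_half_lines (distribution (normal_prob m s) F')
          (normal_prob (a * m + b) (a * s))) => x.
rewrite /distribution /pushforward/= /normal_prob.
pose y := (x - b) / a.
have xy : x = a * y + b by rewrite /y mulrC divfK ?gt_eqF// subrK.
have -> : F' @^-1` `[x, +oo[%classic = `[y, +oo[%classic.
  by apply/seteqP; split=> z /=; rewrite !in_itv/= !andbT {1}xy lerD2r ler_pM2l.
have dF (z : R) : is_derive z 1 (fun z : R => a * z + b : R) a.
  by apply: is_derive_eq; rewrite addr0 /GRing.scale/= mulr1.
have F'E : (fun z : R => a * z + b)^`()%classic = cst a.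
  by apply/funext => z; rewrite derive1E derive_val.
rewrite xy (@increasing_ge0_integration_by_substitutiony _ (fun z => a * z + b)).
- apply: eq_integral => z _; congr EFin => /=.
  rewrite !fctE F'E/=. by rewrite (normal_pdf_affine _ _ a b).
- by move=> u v _ _ uv; rewrite ltrD2r ltr_pM2l.
- by rewrite F'E => ? _; exact: cvg_cst.
- by rewrite F'E; exact: is_cvg_cst.
- by rewrite F'E; exact: is_cvg_cst.
- split; first by move=> z _; case: (dF z).
  apply: cvg_at_right_filter.
  by apply: (@cvgD _ R^o); [apply: cvgM; [exact: cvg_cst|exact: cvg_id]|exact: cvg_cst].
- apply: cvg_comp (cvg_addrr b); apply: (gt0_cvgMry a0); exact: cvg_id.
- apply: continuous_subspaceT; apply: continuous_normal_pdf.
  by rewrite mulf_neq0// gt_eqF.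
- by move=> z _; exact: normal_pdf_ge0.
Qed.

End normal_lemmas.

(** * The standard normal distribution function and its inverse *)

Section Phi_lemmas.
Context {R : realType}.
Implicit Types (x y p : R).
Local Notation leb := (@lebesgue_measure R).

Lemma normal_prob_itvbnd_gt0 x y : x < y -> (0 < normal_prob 0 1 `]x, y])%E.
Proof.
(* [M] bounds the absolute value on the interval, so [c], the density at [M], bounds the density
   there from below. *)
move=> xy; pose M := `|x| + `|y|.
pose c := normal_peak 1 * expR (- M ^+ 2 / (1 ^+ 2 *+ 2)).
have c0 : 0 < c by rewrite mulr_gt0 ?expR_gt0 ?normal_peak_gt0.
apply: (@lt_le_trans _ _ (\int[leb]_(z in `]x, y]) c%:E)%E).
  rewrite integral_cst//= lebesgue_measure_itv/= lte_fin xy -EFinD -EFinM lte_fin.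
  by rewrite mulr_gt0// subr_gt0.
apply: ge0_le_integral => //=.
- by move=> z _; rewrite lee_fin ltW.
- by apply/measurable_funTS/measurable_EFinP; exact: measurable_normal_pdf.
- move=> z; rewrite in_itv/= => /andP[xz zy].
  rewrite lee_fin normal_pdfE ?oner_neq0// /c ler_pM2l ?normal_peak_gt0//.
  rewrite ler_expR ler_pM2r; last by rewrite invr_gt0 expr1n.
  rewrite lerN2 subr0 -[z ^+ 2]real_normK ?num_real// ler_sqr ?nnegrE//.
  + rewrite ler_norml; apply/andP; split.
      by rewrite /M; have := ler_norm (- x); rewrite normrN; have := normr_ge0 y; lra.
    by rewrite /M; have := ler_norm y; have := normr_ge0 x; lra.
  + by rewrite addr_ge0.
Qed.

(** Bounding the density by its peak makes [Phi] Lipschitz, which is how its continuity is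
    obtained. *)
Lemma normal_prob_itvbnd_le x y : x <= y ->
  (normal_prob 0 1 `]x, y] <= (normal_peak 1 * (y - x))%:E)%E.
Proof.
move=> xy.
apply: (@le_trans _ _ (\int[leb]_(z in `]x, y]) (normal_peak 1)%:E)%E).
  apply: ge0_le_integral => //=.
  - by move=> z _; rewrite lee_fin normal_pdf_ge0.
  - by apply/measurable_funTS/measurable_EFinP; exact: measurable_normal_pdf.
  - by move=> z _; rewrite lee_fin normal_pdf_ub ?oner_neq0.
rewrite integral_cst//= lebesgue_measure_itv/= lte_fin.
move: xy; rewrite le_eqVlt => /predU1P[->|xy]; first by rewrite ltxx subrr mulr0 mule0.
by rewrite xy -EFinD -EFinM.
Qed.

Lemma PhiE x : (Phi x)%:E = normal_prob 0 1 `]-oo, x].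
Proof. by rewrite /Phi fineK// fin_num_measure. Qed.

Lemma Phi_itvbnd x y : x <= y ->
  (Phi y)%:E = ((Phi x)%:E + normal_prob 0 1 `]x, y])%E.
Proof.
move=> xy; rewrite !PhiE -measureU//=.
- by rewrite -itv_bndbnd_setU.
- by rewrite -subset0 => z [] /=; rewrite !in_itv/= => zx /andP[]; rewrite ltNge zx.
Qed.

Lemma Phi_lt : {mono @Phi R : x y / x < y}.
Proof.
have H : {homo @Phi R : x y / x < y}.
  move=> x y xy; rewrite -lte_fin (Phi_itvbnd x y) ?ltW//.
  by rewrite lteDl// normal_prob_itvbnd_gt0.
exact: leW_mono (le_mono H).
Qed.

Lemma Phi_inj : injective (@Phi R).
Proof. by move=> x y e; apply/eqP; rewrite eq_le !leNgt -(Phi_lt x y) -(Phi_lt y x) e ltxx. Qed.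

Lemma Phi_continuous : continuous (@Phi R).
Proof.
move=> x; apply/cvgrPdist_le => e e0.
have k0 : 0 < normal_peak (1 : R) by apply: normal_peak_gt0; exact: oner_neq0.
have H (u v : R) : u <= v -> `|Phi v - Phi u| <= normal_peak 1 * (v - u).
  move=> uv; have vu : Phi u <= Phi v by rewrite leNgt Phi_lt -leNgt.
  rewrite ger0_norm ?subr_ge0// lerBlDl -lee_fin EFinD (Phi_itvbnd u v uv).
  by apply: leeD2l; exact: normal_prob_itvbnd_le.
near=> y.
have : `|x - y| <= e / normal_peak 1.
  by near: y; apply: cvgr_dist_le => //; rewrite divr_gt0.
rewrite ler_pdivlMr// mulrC => xye.
have [xy|/ltW yx] := leP x y.
  by rewrite distrC (le_trans (H _ _ xy))// (le_trans _ xye)// ler_pM2l// distrC ler_norm.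
by rewrite (le_trans (H _ _ yx))// (le_trans _ xye)// ler_pM2l// ler_norm.
Unshelve. all: by end_near. Qed.

Lemma Phi_surj p : 0 < p < 1 -> exists x, Phi x = p.
Proof.
move=> /andP[p0 p1].
(* [Phi] is the distribution function of the identity under the standard normal law; its limits 0
   and 1 supply points on both sides of [p] for the intermediate value theorem. *)
pose X := @mfun_Sub _ _ (measurableTypeR R) R idfun (mem_set (@measurable_id _ _ _)).
pose N : probability (measurableTypeR R) R := normal_prob 0 1.
have XE : fine \o @cdf _ _ _ N X = @Phi R by [].
have [a ap] : exists a : R, Phi a <= p.
  have /fine_cvgP[_] := @cvg_cdfNy0 _ _ _ N X.
  rewrite XE => /cvgr_lt/(_ _ p0)[M [_ HM]].
  by exists (M - 1); rewrite ltW// HM// gtrBl.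
have [b bp] : exists b : R, p <= Phi b.
  have /fine_cvgP[_] := @cvg_cdfy1 _ _ _ N X.
  rewrite XE => /cvgr_gt/(_ _ p1)[M [_ HM]].
  by exists (M + 1); rewrite ltW// HM// ltrDl.
have ab : a <= b by rewrite leNgt -Phi_lt -leNgt (le_trans ap).
have [|x _ <-] := @IVT R (@Phi R) a b p ab (continuous_subspaceT Phi_continuous).
  by rewrite ge_min ap le_max bp orbT.
by exists x.
Qed.

Lemma Phi_invK p : 0 < p < 1 -> Phi (Phi_inv p) = p.
Proof. by move=> /Phi_surj[x xp]; exact: (xgetPex 0 (ex_intro (fun x => Phi x = p) x xp)). Qed.

(** The point [x] itself is a solution, so the default value of [Phi_inv] never arises, and
    injectivity identifies the chosen one. *)
Lemma PhiK x : Phi_inv (Phi x) = x.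
Proof.
by apply: Phi_inj; exact: (xgetPex 0 (ex_intro (fun y => Phi y = Phi x) x erefl)).
Qed.

Lemma normal_prob_itvoy x : normal_prob 0 1 `]x, +oo[ = (1 - Phi x)%:E.
Proof.
rewrite EFinB PhiE -(probability_setT (normal_prob 0 1)) -(setUv `]-oo, x]) setCitvl.
rewrite measureU//= ?setICr//.
  by rewrite addeAC subee ?add0e// fin_num_measure.
by rewrite -setCitvl setICr.
Qed.

(** The density is even: reflecting the integral turns the left tail into the right one. *)
Lemma PhiN x : Phi (- x) = 1 - Phi x.
Proof.
apply/EFin_inj; rewrite -normal_prob_itvoy PhiE /normal_prob.
rewrite ge0_integration_by_substitutionNy.
- rewrite integral_itv_obnd_cbnd.
    by apply: eq_integral => z _ /=; rewrite !normal_pdfE ?oner_neq0// /normal_fun !subr0 sqrrN.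
  by apply/measurable_funTS/measurable_EFinP; exact: measurable_normal_pdf.
- by apply: continuous_subspaceT; apply: continuous_normal_pdf; exact: oner_neq0.
- by move=> z _; exact: normal_pdf_ge0.
Qed.

End Phi_lemmas.

(** * Convolution of normal laws *)

Section normal_convolution.
Context {R : realType}.
Local Notation RR := (measurableTypeR R).
Local Notation leb := (@lebesgue_measure R).
Implicit Types (m s u y w : R).

(** Completing the square in [y]. The joint density of a normal [y] and of [w], which is [y] plus
    unit-variance noise of mean [u], factors into the marginal of [w] and the conditional density of
    [y] given [w]. *)
Lemma normal_pdf_conv m s u y w : 0 < s ->
  normal_pdf m s y * normal_pdf (u + y) 1 w =
  normal_pdf (m + u) (Num.sqrt (s ^+ 2 + 1)) w *
  normal_pdf ((m + s ^+ 2 * (w - u)) / (s ^+ 2 + 1)) (s / Num.sqrt (s ^+ 2 + 1)) y.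
Proof.
move=> s0; have t0 : 0 < s ^+ 2 + 1 by rewrite ltr_wpDl ?sqr_ge0.
have st0 : 0 < Num.sqrt (s ^+ 2 + 1) by rewrite sqrtr_gt0.
have sq : Num.sqrt (s ^+ 2 + 1) ^+ 2 = s ^+ 2 + 1 by rewrite sqr_sqrtr// ltW.
rewrite !normal_pdfE ?mulf_neq0 ?invr_eq0 ?gt_eqF// /normal_fun /normal_peak.
have sq' : (s / Num.sqrt (s ^+ 2 + 1)) ^+ 2 = s ^+ 2 / (s ^+ 2 + 1).
  by rewrite expr_div_n sq.
have ge0 x : 0 <= x ^+ 2 * (pi : R) *+ 2 by rewrite mulrn_wge0// mulr_ge0 ?sqr_ge0 ?pi_ge0.
rewrite [LHS]mulrACA [RHS]mulrACA -!expRD; congr (_ * expR _).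
  rewrite -!invfM -!sqrtrM//; congr ((Num.sqrt _)^-1).
  by rewrite sq sq' expr1n; field; rewrite gt_eqF.
rewrite sq sq' expr1n; field.
by rewrite !gt_eqF.
Qed.

(** After Tonelli exchanges the integrals, [normal_pdf_conv] leaves a density in [y] that integrates
    to one. *)
Lemma normal_prob_conv m s u (A : set R) : 0 < s -> measurable A ->
  (\int[normal_prob m s]_y normal_prob u 1 [set z | A (y + z)%R] =
   normal_prob (m + u) (Num.sqrt (s ^+ 2 + 1)) A)%E.
Proof.
move=> s0 mA; have s1 : s != 0 by rewrite gt_eqF.
have t0 : 0 < s ^+ 2 + 1 by rewrite ltr_wpDl ?sqr_ge0.
have st0 : 0 < Num.sqrt (s ^+ 2 + 1) by rewrite sqrtr_gt0.
(* The inner probability becomes an integral over the value [w] of the sum, so that [y] can be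
   integrated out first. *)
have shift y : normal_prob u 1 [set z | A (y + z)%R] =
    (\int[leb]_w (normal_pdf (u + y) 1 w * \1_A w)%:E)%E.
  have := normal_prob_affine u 1 1 y A (oner_neq0 _) ltr01 mA.
  rewrite !mul1r => H; transitivity (normal_prob (u + y) 1 A).
    by rewrite -H; congr normal_prob; apply/seteqP; split => z /=; rewrite mul1r addrC.
  rewrite /normal_prob integral_mkcond/= restrict_EFin.
  apply: eq_integral => w _; congr EFin.
  by rewrite patchE indicE; case: ifPn; rewrite ?mulr1 ?mulr0.
have mpdf : measurable_fun setT (fun z : RR * RR => normal_pdf (u + z.1) 1 z.2).
  rewrite (_ : (fun z : RR * RR => _) =
      (@normal_pdf R 0 1) \o (fun z : RR * RR => z.2 - (u + z.1))); last first.
    apply/funext => z /=; rewrite !normal_pdfE ?oner_neq0//.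
    by rewrite /normal_fun subr0.
  apply: measurableT_comp; first exact: measurable_normal_pdf.
  by apply: measurable_funB => //; apply: measurable_funD.
have mI : measurable_fun setT (fun z : RR * RR => \1_A z.2 : R).
  by apply: measurableT_comp => //; exact: measurable_indic.
have mf : measurable_fun setT (fun z : RR * RR =>
    (normal_pdf (u + z.1) 1 z.2 * \1_A z.2 * normal_pdf m s z.1)%:E).
  apply/measurable_EFinP; apply: measurable_funM; first exact: measurable_funM.
  by apply: measurableT_comp => //; exact: measurable_normal_pdf.
have f0 z : (0 <= (normal_pdf (u + z.1) 1 z.2 * \1_A z.2 * normal_pdf m s z.1)%:E)%E.
  by rewrite lee_fin !mulr_ge0 ?normal_pdf_ge0.
rewrite ge0_integral_normal_prob//=; last first.
  under eq_fun do rewrite shift.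
  have mg : measurable_fun setT (fun z : RR * RR =>
      (normal_pdf (u + z.1) 1 z.2 * \1_A z.2)%:E).
    by apply/measurable_EFinP; exact: measurable_funM.
  have g0 z : (0 <= (normal_pdf (u + z.1) 1 z.2 * \1_A z.2)%:E)%E.
    by rewrite lee_fin mulr_ge0 ?normal_pdf_ge0.
  exact: (@measurable_fun_fubini_tonelli_F _ _ RR RR R leb _ mg g0).
transitivity (\int[leb]_y \int[leb]_w
    (normal_pdf (u + y) 1 w * \1_A w * normal_pdf m s y)%:E)%E.
  apply: eq_integral => y _; rewrite shift -ge0_integralZr//.
  - apply/measurable_EFinP; apply: measurable_funM; last exact: measurable_indic.
    exact: measurable_normal_pdf.
  - by move=> w _; rewrite lee_fin mulr_ge0 ?normal_pdf_ge0.
  - by rewrite lee_fin normal_pdf_ge0.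
rewrite (fubini_tonelli (fun z : RR * RR =>
    (normal_pdf (u + z.1) 1 z.2 * \1_A z.2 * normal_pdf m s z.1)%:E))//=.
rewrite /normal_prob [RHS]integral_mkcond/=; apply: eq_integral => w _.
transitivity (\int[leb]_y ((normal_pdf (m + u) (Num.sqrt (s ^+ 2 + 1)) w * \1_A w)%:E
    * (normal_pdf ((m + s ^+ 2 * (w - u)) / (s ^+ 2 + 1)) (s / Num.sqrt (s ^+ 2 + 1)) y)%:E))%E.
  apply: eq_integral => y _; rewrite -EFinM; congr EFin.
  by rewrite [RHS]mulrAC -normal_pdf_conv//; ring.
rewrite ge0_integralZl//=.
- rewrite integral_normal_pdf mule1 patchE indicE.
  by case: ifPn; rewrite ?mulr1 ?mulr0.
- by apply/measurable_EFinP; exact: measurable_normal_pdf.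
- by move=> y _; rewrite lee_fin normal_pdf_ge0.
- by rewrite lee_fin mulr_ge0 ?normal_pdf_ge0.
Qed.

End normal_convolution.

(** * Independence of the past from the remaining coordinates *)

Section independence.
Context {d} {T : measurableType d} {R : realType}.
Local Notation RR := (measurableTypeR R).
Variables (P : probability T R) (n : nat) (X : nat -> {mfun T >-> RR}).
Hypothesis X_indep : forall B : nat -> set RR, (forall i, measurable (B i)) ->
  P [set t | forall i, (i < n)%N -> B i (X i t)] =
  (\prod_(0 <= i < n) P (X i @^-1` B i))%E.

Definition future k (B : nat -> set RR) :=
  [set t | forall i, (k <= i < n)%N -> B i (X i t)].

Lemma measurable_future k B : (forall i, measurable (B i)) ->
  measurable (future k B).
Proof.
move=> mB.
rewrite (_ : future k B =
  \bigcap_(i in [set i | (k <= i < n)%N]) (X i @^-1` B i)); last by [].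
apply: bigcap_measurableType => i _.
by rewrite -[X in measurable X]setTI; exact: measurable_funP.
Qed.

Lemma prob_future k B : (k <= n)%N -> (forall i, measurable (B i)) ->
  P (future k B) = (\prod_(k <= i < n) P (X i @^-1` B i))%E.
Proof.
move=> kn mB; pose B' i := if (k <= i)%N then B i else setT.
rewrite (_ : future k B = [set t | forall i, (i < n)%N -> B' i (X i t)]); last first.
  apply/seteqP; split=> t /= H i.
    by rewrite /B'; case: ifPn => // ki i_n; apply: H; rewrite ki.
  by move=> /andP[ki i_n]; have := H i i_n; rewrite /B' ki.
rewrite X_indep; last by move=> i; rewrite /B'; case: ifP.
rewrite (@big_cat_nat _ _ _ k)//= big_nat_cond big1 ?mul1e.
  by apply: eq_big_nat => i /andP[ki _]; rewrite /B' ki.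
move=> i; rewrite andbT => /andP[_ ik].
by rewrite /B' leqNgt ik preimage_setT probability_setT.
Qed.

(** This is the invariant carried along the walk. Boxes in the remaining coordinates are enough,
    since every later use of independence goes through uniqueness of product measures. *)
Definition indep_future k (Y : T -> RR) :=
  measurable_fun setT Y /\
  forall A B, measurable A -> (forall i, measurable (B i)) ->
    P (Y @^-1` A `&` future k B) = (P (Y @^-1` A) * P (future k B))%E.

Lemma indep_future_cst k c : indep_future k (cst c).
Proof.
split=> // A B mA mB; have [Ac|nAc] := pselect (A c).
  rewrite (_ : cst c @^-1` A = setT); last by apply/seteqP; split.
  by rewrite setTI probability_setT mul1e.
rewrite (_ : cst c @^-1` A = set0); last by apply/seteqP; split.
by rewrite set0I measure0 mul0e.
Qed.

Definition to_mfun (Y : T -> RR) (mY : measurable_fun setT Y) : {mfun T >-> RR} :=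
  @mfun_Sub _ _ T RR Y (mem_set mY).

(** Conditionally on the future event, the law of the pair agrees with the product measure on
    rectangles, hence everywhere. Keeping the future in the statement is what lets independence pass
    to [k.+1]. *)
Lemma pair_law k (Y : {mfun T >-> RR}) B (C : set (RR * RR)) : (k < n)%N ->
  indep_future k Y -> (forall i, measurable (B i)) -> measurable C ->
  P ((fun t => (Y t, X k t)) @^-1` C `&` future k.+1 B) =
  ((distribution P Y \x distribution P (X k)) C * P (future k.+1 B))%E.
Proof.
move=> kn [_ iY] mB mC.
have mF : measurable (future k.+1 B) by exact: measurable_future.
(* A null event cannot be conditioned on, but then both sides vanish. *)
have [F0|F0] := eqVneq (P (future k.+1 B)) 0%E.
  rewrite F0 mule0; apply/eqP; rewrite eq_le measure_ge0 andbT -F0.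
  apply: le_measure; rewrite ?inE//; apply: measurableI => //.
  rewrite -[X in measurable X]setTI.
  by apply: measurable_fun_pair => //; exact: measurable_funP.
have Ffin : P (future k.+1 B) \is a fin_num by rewrite fin_num_measure.
pose f := fine (P (future k.+1 B)).
have f0 : 0 <= f by rewrite fine_ge0.
have fE : P (future k.+1 B) = f%:E by rewrite /f fineK.
have fn0 : f != 0 by move: F0; rewrite fE eqe.
have mW : measurable_fun setT (fun t => (Y t, X k t)).
  by apply: measurable_fun_pair; exact: measurable_funP.
pose W : {mfun T >-> (RR * RR)%type} := @mfun_Sub _ _ T (RR * RR)%type _ (mem_set mW).
(* [Q] is [P] conditioned on the future event; the second argument of [mnormalize] is a fallback for
   degenerate mass, excluded here. *)
pose Q : probability T R := mnormalize (mrestr P mF) P.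
have QE A : Q A = (P (A `&` future k.+1 B) * (f^-1)%:E)%E.
  have ET : mrestr P mF setT = f%:E by rewrite /mrestr setTI.
  rewrite /Q/= /mnormalize/=; move: ET; rewrite /mrestr => ET.
  by rewrite !ET eqe (negbTE fn0).
rewrite (@product_measure_unique _ _ RR RR R (distribution P Y)
  (distribution P (X k)) (distribution Q W))//.
  apply/esym; etransitivity.
    exact: (congr1 (fun x => x * P (future k.+1 B))%E (QE (W @^-1` C))).
  by rewrite fE -muleA -EFinM mulVf// mule1.
move=> A B0 mA mB0; etransitivity; first exact: (QE (W @^-1` (A `*` B0))).
(* The constraint on [X k] joins the later ones into a box starting at [k], to which the
   independence of [Y] applies. *)
pose B' i := if i == k then B0 else B i.
have mB' i : measurable (B' i) by rewrite /B'; case: ifP.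
have -> : W @^-1` (A `*` B0) `&` future k.+1 B = Y @^-1` A `&` future k B'.
  apply/seteqP; split=> t /=.
    move=> [[At B0t] H]; split=> // i /andP[ki i_n]; rewrite /B'.
    by case: eqVneq => [->//|ik]; apply: H; rewrite ltn_neqAle eq_sym ik ki.
  move=> [At H]; split; first split=> //=.
    by have := H k; rewrite /B' eqxx leqnn; exact.
  move=> i /andP[ki i_n]; have := H i; rewrite /B' gtn_eqF// i_n (ltnW ki); exact.
rewrite iY// !prob_future//; last exact: ltnW.
rewrite big_ltn// {1}/B' eqxx.
have -> : (\prod_(k.+1 <= i < n) P (X i @^-1` B' i) = f%:E)%E.
  rewrite -fE prob_future//; apply: eq_big_nat => i /andP[ki _].
  by rewrite /B' gtn_eqF.
by rewrite -!muleA -EFinM mulfV// mule1.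
Qed.

(** [pair_law] serves twice: with the boxes [B], and with trivial boxes to recognise the product
    measure as the law of the new variable. *)
Lemma indep_future_step k (Y : T -> RR) (h : RR * RR -> RR) : (k < n)%N ->
  measurable_fun setT h -> indep_future k Y ->
  indep_future k.+1 (fun t => h (Y t, X k t)).
Proof.
move=> kn mh iY; have mY := iY.1; pose Y' := to_mfun Y mY.
split.
  apply: measurableT_comp => //.
  by apply: measurable_fun_pair => //; exact: measurable_funP.
move=> A B mA mB.
have mhA : measurable (h @^-1` A) by rewrite -[X in measurable X]setTI; exact: mh.
have H := pair_law k Y' _ (h @^-1` A) kn iY _ mhA.
have := H B mB; rewrite /Y'/= => ->; congr (_ * _)%E.
have := H (fun _ => setT) (fun _ => measurableT).
rewrite (_ : future k.+1 _ = setT); last by apply/seteqP; split.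
by rewrite setIT probability_setT mule1 => <-.
Qed.

(** The pair has a product law, so Tonelli integrates [X k] out with [Y] held fixed; this plays the
    role of conditional expectation. *)
Lemma indep_future_integral k (Y : T -> RR) (f : RR * RR -> \bar R) : (k < n)%N ->
  indep_future k Y -> measurable_fun setT f -> (forall x, (0 <= f x)%E) ->
  (\int[P]_t f (Y t, X k t) =
   \int[P]_t \int[distribution P (X k)]_z f (Y t, z))%E.
Proof.
move=> kn iY mf f0; have mY := iY.1; pose Y' := to_mfun Y mY.
have mW : measurable_fun setT (fun t => (Y t, X k t)).
  by apply: measurable_fun_pair => //; exact: measurable_funP.
pose W : {mfun T >-> (RR * RR)%type} := @mfun_Sub _ _ T (RR * RR)%type _ (mem_set mW).
transitivity (\int[distribution P W]_x f x)%E.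
  by rewrite ge0_integral_distribution.
rewrite (eq_measure_integral (distribution P Y' \x distribution P (X k))%E); last first.
  move=> C mC _.
  have := pair_law k Y' (fun _ => setT) C kn iY (fun _ => measurableT) mC.
  rewrite (_ : future k.+1 _ = setT); last by apply/seteqP; split.
  by rewrite setIT probability_setT mule1.
rewrite fubini_tonelli1// ge0_integral_distribution//.
- exact: (measurable_fun_fubini_tonelli_F (m2 := distribution P (X k)) f).
- by move=> y; exact: integral_ge0.
Qed.

End independence.

(** * The stopped exponential martingale and Ville's inequality *)

Section gaussian_walk.
Context {d} {T : measurableType d} {R : realType}.
Local Notation RR := (measurableTypeR R).
Variables (P : probability T R) (n : nat) (X : nat -> {mfun T >-> RR}) (mu : nat -> R).
Hypothesis X_indep : forall B : nat -> set RR, (forall i, measurable (B i)) ->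
  P [set t | forall i, (i < n)%N -> B i (X i t)] =
  (\prod_(0 <= i < n) P (X i @^-1` B i))%E.
Hypothesis X_law : forall i (A : set RR), (i < n)%N -> measurable A ->
  P (X i @^-1` A) = normal_prob (mu i) 1 A.

(** Exponential tilting: the factor turns the density of mean [m] into that of mean [m + lam]. *)
Lemma normal_prob_exp_moment (m lam : R) :
  (\int[normal_prob m 1]_z (expR (lam * (z - m) - lam ^+ 2 / 2))%:E = 1)%E.
Proof.
rewrite ge0_integral_normal_prob ?oner_neq0//; last first.
  apply/measurable_EFinP; apply: measurableT_comp => //.
  by apply: measurable_funB => //; apply: measurable_funM => //; apply: measurable_funB.
rewrite -(integral_normal_pdf (m + lam) 1); apply: eq_integral => z _.
rewrite -EFinM !normal_pdfE ?oner_neq0// mulrCA; congr ((_ * _)%:E).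
by rewrite /normal_fun -expRD; congr expR; field.
Qed.

Variables (lam L : R).

(** Stopping is encoded by freezing the value, so no stopping time enters and each step depends only
    on the last value and the next coordinate. *)
Let h k (yz : RR * RR) : RR :=
  if L <= yz.1 then yz.1 else yz.1 * expR (lam * (yz.2 - mu k) - lam ^+ 2 / 2).

Let measurable_h k : measurable_fun setT (h k).
Proof.
apply: measurable_fun_if => //.
- apply: (measurable_fun_bool true).
  rewrite setTI (_ : _ @^-1` _ = fst @^-1` `[L, +oo[%classic); last first.
    by apply/seteqP; split => x /=; rewrite in_itv/= andbT.
  by rewrite -[X in measurable X]setTI; exact: measurable_fst.
- by apply: measurable_funTS.
- apply: measurable_funTS; apply: measurable_funM => //.
  apply: measurableT_comp => //; apply: measurable_funB => //.
  by apply: measurable_funM => //; apply: measurable_funB.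
Qed.

(* The exponential martingale of the centred walk, stopped on reaching [L]. *)
Fixpoint stopped_exp k (t : T) : RR :=
  if k is k'.+1 then h k' (stopped_exp k' t, X k' t) else 1.

Lemma stopped_exp_ge0 k t : 0 <= stopped_exp k t.
Proof.
elim: k => [|k IH] /=; first exact: ler01.
by rewrite /h/=; case: ifP => // _; rewrite mulr_ge0 ?expR_ge0.
Qed.

Lemma stopped_exp_indep k : (k <= n)%N -> indep_future P n X k (stopped_exp k).
Proof.
elim: k => [|k IH] kn; first exact: indep_future_cst.
exact: (indep_future_step P n X X_indep k _ _ kn (measurable_h k) (IH (ltnW kn))).
Qed.

(** Integrating out [X k] keeps a frozen value, and otherwise multiplies by an exponential factor of
    mean one. *)
Lemma stopped_exp_expectation k : (k <= n)%N -> (\int[P]_t (stopped_exp k t)%:E = 1)%E.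
Proof.
elim: k => [|k IH] kn.
  by rewrite /= integral_cst//= probability_setT mule1.
rewrite -(IH (ltnW kn)) /=.
(* [h] takes negative values when its first argument is negative, while Tonelli needs a nonnegative
   integrand; the maximum with 0 changes nothing at the values actually attained. *)
have mE : measurable_fun setT (fun yz : RR * RR => (Num.max 0 (h k yz))%:E).
  by apply/measurable_EFinP; apply: measurable_maxr => //; exact: measurable_h.
have g0 (yz : RR * RR) : (0 <= (Num.max 0 (h k yz))%:E)%E by rewrite lee_fin le_max lexx.
have hge0 t z : Num.max 0 (h k (stopped_exp k t, z)) = h k (stopped_exp k t, z).
  have y0 := stopped_exp_ge0 k t; apply/max_idPr; rewrite /h/=; case: ifP => // _.
  by rewrite mulr_ge0 ?expR_ge0.
transitivity (\int[P]_t (Num.max 0 (h k (stopped_exp k t, X k t)))%:E)%E.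
  by apply: eq_integral => t _; rewrite hge0.
rewrite (indep_future_integral P n X X_indep k (stopped_exp k) _ kn
  (stopped_exp_indep _ (ltnW kn)) mE g0).
apply: eq_integral => t _.
transitivity (\int[distribution P (X k)]_z (h k (stopped_exp k t, z))%:E)%E.
  by apply: eq_integral => z _; rewrite hge0.
rewrite (eq_measure_integral (normal_prob (mu k) 1)); last first.
  by move=> A mA _; exact: X_law.
rewrite /h/=; case: (L <= stopped_exp k t).
  by rewrite integral_cst//= probability_setT mule1.
under eq_integral do rewrite EFinM.
rewrite ge0_integralZl//=.
- by rewrite normal_prob_exp_moment mule1.
- apply/measurable_EFinP; apply: measurableT_comp => //.
  by apply: measurable_funB => //; apply: measurable_funM => //; apply: measurable_funB.
- by rewrite lee_fin stopped_exp_ge0.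
Qed.

(** Before freezing, the process is the plain exponential; hence whenever that exponential is at
    least [L], so is the stopped process. *)
Lemma stopped_exp_reached k t :
  L <= stopped_exp k t \/
  stopped_exp k t = expR (\sum_(0 <= i < k) (lam * (X i t - mu i) - lam ^+ 2 / 2)).
Proof.
elim: k => [|k IH] /=; first by right; rewrite big_geq// expR0.
rewrite /h/=; case: ifPn => [|nL]; first by left.
right; case: IH => [LE|->]; first by rewrite LE in nL.
by rewrite big_nat_recr//= [RHS]expRD.
Qed.

(** Freezing makes a visit to [L] at any time visible at the final time. *)
Lemma stopped_exp_stays k m t : (k <= m)%N -> L <= stopped_exp k t ->
  L <= stopped_exp m t.
Proof.
elim: m => [|m IH]; first by rewrite leqn0 => /eqP ->.
rewrite leq_eqVlt => /predU1P[->//|]; rewrite ltnS => km /(IH km) H.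
by rewrite /= /h/= H.
Qed.

Lemma measurable_stopped_exp_ge : measurable [set t | L <= stopped_exp n t].
Proof.
have [mS _] := stopped_exp_indep _ (leqnn n).
rewrite (_ : [set t | _] = stopped_exp n @^-1` `[L, +oo[%classic); last first.
  by apply/seteqP; split => x /=; rewrite in_itv/= andbT.
by rewrite -[X in measurable X]setTI; exact: mS.
Qed.

(** Markov's inequality for the final value, whose mean is one. *)
Lemma stopped_exp_tail : 0 < L -> (P [set t | (L <= stopped_exp n t)%R] <= (L^-1)%:E)%E.
Proof.
move=> L0; have [mS _] := stopped_exp_indep _ (leqnn n).
have mA := measurable_stopped_exp_ge.
rewrite -(@lee_pmul2l _ L%:E)// -EFinM divff ?gt_eqF//.
rewrite -(stopped_exp_expectation _ (leqnn n)).
rewrite -(setIT [set t | _]) -integral_indic// -ge0_integralZl//=.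
- apply: ge0_le_integral => //=.
  + by move=> t _; rewrite lee_fin mulr_ge0// ltW.
  + by apply/measurable_EFinP; apply: measurable_funM => //; exact: measurable_indic.
  + exact/measurable_EFinP.
  + move=> t _; rewrite lee_fin indicE; case: (boolP (_ \in _)) => [|_].
      by rewrite inE/= mulr1.
    by rewrite mulr0 stopped_exp_ge0.
- by apply/measurable_EFinP; exact: measurable_indic.
- by rewrite lee_fin ltW.
Qed.

End gaussian_walk.

(** * Numerical bounds for the sum over the epochs *)

Section numeric_bounds.
Context {R : realType}.
Implicit Types (x g : R).

(** The bound [1 - y <= expR (- y)] at [y = x / n], raised to the power [n]; it yields rational
    lower bounds for logarithms. *)
Lemma expR_mul_le1 (n : nat) x : (0 < n)%N -> x < n%:R ->
  expR x * (1 - x / n%:R) ^+ n <= 1.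
Proof.
move=> n0 xn; have n0' : 0 < n%:R :> R by rewrite ltr0n.
have p : 0 < 1 - x / n%:R by rewrite subr_gt0 ltr_pdivrMr// mul1r.
rewrite -[x in expR x](divfK (lt0r_neq0 n0')) expRM_natr -exprMn.
rewrite exprn_ile1 ?mulr_ge0 ?expR_ge0 ?(ltW p)//.
by rewrite mulrC -ler_pdivlMr ?expR_gt0// div1r -expRN expR_ge1Dx.
Qed.

Lemma ln2_lower_bound : 69 / 100 <= ln 2 :> R.
Proof.
rewrite -[leLHS]expRK ler_ln ?posrE ?expR_gt0//.
have sq (a b c : R) (m : nat) : 0 <= b -> c <= b ^+ 2 -> b <= a ^+ m ->
    c <= a ^+ (m * 2).
  move=> b0 cb ba; apply: (le_trans cb); rewrite exprM ler_pXn2r ?nnegrE//.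
  exact: (le_trans b0).
(* The goal reduces to [a ^+ 128 >= 1/2], reached by repeated squaring with each result rounded down
   to keep the rationals small. *)
pose a : R := 1 - 69 / 100 / 128.
have a2 : (989 + 24 / 100) / 1000 <= a ^+ 2 by rewrite /a; lra.
have a4 : (978 + 59 / 100) / 1000 <= a ^+ 4 by apply: sq a2; lra.
have a8 : (957 + 63 / 100) / 1000 <= a ^+ 8 by apply: sq a4; lra.
have a16 : (917 + 5 / 100) / 1000 <= a ^+ 16 by apply: sq a8; lra.
have a32 : (840 + 98 / 100) / 1000 <= a ^+ 32 by apply: sq a16; lra.
have a64 : (707 + 24 / 100) / 1000 <= a ^+ 64 by apply: sq a32; lra.
have := @expR_mul_le1 (64 * 2) (69 / 100) isT ltac:(rewrite natrM; lra).
rewrite (_ : 1 - _ = a); last by rewrite natrM /a; field.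
rewrite exprM; move: (a ^+ 64) a64 => b b2 H; clear -b2 H.
move: (expR (69 / 100)) (expR_gt0 (69 / 100 : R)) H => e e0 H.
by nra.
Qed.

Lemma ln52_lower_bound : 16 / 10 <= ln (52 / 10) :> R.
Proof.
have p : 0 < 52 / 10 :> R by lra.
rewrite -[leLHS]expRK ler_ln ?posrE ?expR_gt0//.
have := @expR_mul_le1 32 (16 / 10) isT ltac:(lra).
rewrite (_ : 1 - 16 / 10 / 32%:R = 95 / 100); last by field.
have : 10 / 52 <= (95 / 100) ^+ 32 :> R by lra.
move: ((95 / 100) ^+ 32) => b b2.
move: (expR (16 / 10)) (expR_gt0 (16 / 10 : R)) => e e0 H; clear p.
by nra.
Qed.

(** The last factor on the left is the quotient of [B ^+ 5 - A ^+ 5] by [B - A]. The difference of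
    the sides is a square times a polynomial with positive coefficients. *)
Lemma fifth_root_ineq (A B : R) : 0 <= A -> 0 <= B ->
  A * B * (B ^+ 4 + B ^+ 3 * A + B ^+ 2 * A ^+ 2 + B * A ^+ 3 + A ^+ 4) <=
  5 / 4 * (A + B) * (A ^+ 5 + B ^+ 5).
Proof.
move=> A0 B0; rewrite -subr_ge0.
rewrite (_ : _ - _ = (A - B) ^+ 2 / 4 *
  (5 * A ^+ 4 + 11 * A ^+ 3 * B + 13 * A ^+ 2 * B ^+ 2 + 11 * A * B ^+ 3 + 5 * B ^+ 4)).
  by rewrite mulr_ge0 ?divr_ge0 ?sqr_ge0 ?addr_ge0 ?mulr_ge0 ?exprn_ge0.
by field.
Qed.

(** The midpoint inequality for the convex function [t ^ (-7/5)]: the right side is its integral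
    over the unit interval centred at [x]. The proof is algebraic, in terms of fifth roots. *)
Lemma power_75_telescope x : 1 <= x ->
  expR (- (7 / 5) * ln x) <=
  5 / 2 * (expR (- (2 / 5) * ln (x - 1 / 2)) - expR (- (2 / 5) * ln (x + 1 / 2))).
Proof.
move=> x1.
have root y : 0 < y -> exists2 a : R, 0 < a & a ^+ 5 = y /\
    (forall m, expR (- (m%:R / 5) * ln y) = a ^- m).
  move=> y0; exists (expR (ln y / 5)); first exact: expR_gt0.
  split; first by rewrite -expRM_natr divfK ?pnatr_eq0// lnK.
  by move=> m; rewrite -expRM_natr -expRN; congr expR; field.
have [A A0 [A5 ->]] : exists2 a : R, 0 < a & a ^+ 5 = x - 1 / 2 /\
    (forall m, expR (- (m%:R / 5) * ln (x - 1 / 2)) = a ^- m) by apply: root; lra.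
have [B B0 [B5 ->]] : exists2 a : R, 0 < a & a ^+ 5 = x + 1 / 2 /\
    (forall m, expR (- (m%:R / 5) * ln (x + 1 / 2)) = a ^- m) by apply: root; lra.
have [J J0 [J5 ->]] : exists2 a : R, 0 < a & a ^+ 5 = x /\
    (forall m, expR (- (m%:R / 5) * ln x) = a ^- m) by apply: root; lra.
have ABJ : A * B <= J ^+ 2.
  rewrite -(@ler_pXn2r _ 5)// ?nnegrE ?mulr_ge0 ?exprn_ge0 ?(ltW A0) ?(ltW B0) ?(ltW J0)//.
  by rewrite exprMn -exprM mulnC exprM A5 B5 J5; nra.
have S5 : A ^+ 5 + B ^+ 5 = 2 * J ^+ 5 by rewrite A5 B5 J5; field.
have D5 : B ^+ 5 - A ^+ 5 = 1 by rewrite A5 B5; field.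
have AltB : A < B.
  rewrite -(@ltr_pXn2r _ 5)// ?nnegrE ?(ltW A0) ?(ltW B0)//; lra.
have := fifth_root_ineq A B (ltW A0) (ltW B0); rewrite S5.
set Q := (_ + A ^+ 4) => HQ.
have DQ : (B - A) * Q = 1 by rewrite -D5 /Q; ring.
have Q0 : 0 < Q.
  by rewrite /Q !addr_gt0// ?mulr_gt0// ?exprn_gt0.
(* This is the claim with denominators cleared and multiplied by [Q], the inverse of [B - A]. *)
have key : A ^+ 2 * B ^+ 2 * Q <= 5 / 2 * (A + B) * J ^+ 7.
  apply: (@le_trans _ _ (J ^+ 2 * (A * B * Q))).
    rewrite (_ : A ^+ 2 * B ^+ 2 * Q = (A * B) * (A * B * Q)); last by ring.
    by rewrite ler_pM2r// !mulr_gt0.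
  rewrite (_ : 5 / 2 * (A + B) * J ^+ 7 = J ^+ 2 * (5 / 4 * (A + B) * (2 * J ^+ 5))); last by field.
  by rewrite ler_pM2l// exprn_gt0.
rewrite (_ : 5 / 2 * _ = 5 / 2 * (A + B) * (B - A) / (A ^+ 2 * B ^+ 2)); last first.
  by field; rewrite !gt_eqF.
rewrite ler_pdivlMr ?mulr_gt0 ?exprn_gt0// mulrC ler_pdivrMr ?exprn_gt0//.
rewrite -(ler_pM2r Q0) -[leRHS](_ : 5 / 2 * (A + B) * J ^+ 7 * ((B - A) * Q) = _); last by ring.
by rewrite DQ mulr1.
Qed.

Lemma power_75_sum (N : nat) :
  \sum_(0 <= j < N) expR (- (7 / 5) * ln j.+1%:R) <= 391 / 125 :> R.
Proof.
pose G (y : R) := expR (- (2 / 5) * ln y).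
have G0 : G (3 / 2) <= 851 / 1000.
  have p : 0 < 3 / 2 :> R by lra.
  have q : 0 <= 851 / 1000 :> R by lra.
  rewrite /G -(@ler_pXn2r _ 5) ?nnegrE ?expR_ge0 ?q //.
  rewrite -expRM_natr (_ : _ * 5 = - (ln (3 / 2) * 2)); last by field.
  by rewrite expRN expRM_natr lnK ?posrE //; lra.
(* The first term is kept exactly, since the midpoint bound is too lossy there; the telescoping
   starts at 2. *)
have H m : \sum_(0 <= j < m.+1) expR (- (7 / 5) * ln j.+1%:R) <=
    1 + 5 / 2 * (G (3 / 2) - G (m.+1%:R + 1 / 2)) :> R.
  elim: m => [|m IH].
    rewrite big_nat1 ln1 mulr0 expR0 (_ : 1%:R + 1 / 2 = 3 / 2 :> R); last by field.
    by rewrite subrr mulr0 addr0.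
  rewrite big_nat_recr//=.
  have := @power_75_telescope m.+2%:R; rewrite -/(G _) -/(G _) => tel.
  have {}tel := tel _.
  have e : m.+2%:R - 1 / 2 = m.+1%:R + 1 / 2 :> R by rewrite -[m.+2%:R]natr1; field.
  rewrite e in tel.
  have := tel ltac:(by rewrite ler1n); lra.
have q : 0 <= 391 / 125 :> R by lra.
case: N => [|m]; first by rewrite big_mkord big_ord0; exact: q.
have := H m; have : 0 <= G (m.+1%:R + 1 / 2) by exact: expR_ge0.
lra.
Qed.

Lemma ln_ln2_bound : expR (- (7 / 5) * ln (ln 2)) <= 841 / 500 :> R.
Proof.
have l2 := ln2_lower_bound.
have l0 : 0 < ln 2 :> R by lra.
have q : 0 <= 841 / 500 :> R by lra.
rewrite -(@ler_pXn2r _ 5) ?nnegrE ?expR_ge0 ?q//.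
rewrite -expRM_natr (_ : _ * 5 = - (ln (ln 2) * 7)); last by field.
rewrite expRN expRM_natr lnK ?posrE//.
apply: (@le_trans _ _ ((69 / 100) ^- 7)); last by lra.
have s : 0 < 69 / 100 :> R by lra.
rewrite lef_pV2 ?posrE ?exprn_gt0//.
by rewrite ler_pXn2r ?nnegrE ?(ltW s) ?(ltW l0).
Qed.

(** The expression under the square root of [Ccurv] at [k = 2 ^ j], as the logarithm of [2 * 2 ^ j]
    is [j.+1 * ln 2]. *)
Definition epoch_exponent (g : R) (j : nat) : R :=
  ln (j.+1%:R * ln 2) + 72 / 100 * ln (52 / 10 / g).

Lemma epoch_sum_lt g (N : nat) : 0 < g < 1 ->
  \sum_(0 <= j < N) expR (- (7 / 5 * epoch_exponent g j)) < g.
Proof.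
move=> /andP[g0 g1].
have l0 : 0 < ln 2 :> R by have := ln2_lower_bound; lra.
have -> : \sum_(0 <= j < N) expR (- (7 / 5 * epoch_exponent g j)) =
   (\sum_(0 <= j < N) expR (- (7 / 5) * ln j.+1%:R)) *
   (expR (- (7 / 5) * ln (ln 2)) * expR (- (126 / 125) * ln (52 / 10 / g))).
  rewrite big_distrl/=; apply: eq_bigr => j _; rewrite -!expRD; congr expR.
  by rewrite /epoch_exponent lnM ?posrE//; field.
have E : expR (- (126 / 125) * ln (52 / 10 / g)) <= g * (500 / 2633).
  have p : 0 < 52 / 10 :> R by lra.
  rewrite ln_div ?posrE//.
  rewrite (_ : - (126 / 125) * (ln (52 / 10) - ln g) = (ln g + 1 / 125 * ln g)
     - (ln (52 / 10) + 1 / 125 * ln (52 / 10))); last by field.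
  rewrite expRD expRN ler_pM ?expR_ge0 ?invr_ge0 ?expR_ge0//.
    rewrite -[leRHS]lnK ?posrE// ler_expR.
    have : ln g <= 0 by rewrite ln_le0// ltW.
    lra.
  have q : 0 < 2633 / 500 :> R by lra.
  rewrite (_ : 500 / 2633 = (2633 / 500)^-1); last by rewrite invf_div.
  rewrite lef_pV2 ?posrE ?expR_gt0//.
  rewrite expRD lnK ?posrE//.
  have := expR_ge1Dx (1 / 125 * ln (52 / 10) : R).
  have := ln52_lower_bound; lra.
have s1 := power_75_sum N; have s2 := ln_ln2_bound.
have s0 : 0 <= \sum_(0 <= j < N) expR (- (7 / 5) * ln j.+1%:R) :> R.
  by apply: sumr_ge0 => j _; exact: expR_ge0.
(* The constants multiply to 328831/329125, just below 1. *)
have num : 391 / 125 * (841 / 500 * (g * (500 / 2633))) < g by lra.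
apply: le_lt_trans num; apply: ler_pM => //.
by apply: ler_pM; rewrite ?expR_ge0.
Qed.

End numeric_bounds.

(** * The curved boundary and the lines below it *)

Section curved_boundary.
Context {R : realType}.
Implicit Types (g w : R).

Definition boundary_exponent (k : nat) g : R :=
  ln (ln (2 * k%:R)) + 72 / 100 * ln (52 / 10 / g).

(** The worst case is [k = 1], where the iterated logarithm is at least [ln (69 / 100)], itself at
    least -31/69. *)
Lemma boundary_exponent_ge k g : (0 < k)%N -> 0 < g < 1 ->
  - (9 / 20) + 72 / 100 * (16 / 10 - ln g) <= boundary_exponent k g.
Proof.
move=> k0 /andP[g0 g1]; have l2 := @ln2_lower_bound R.
have p : 0 < 52 / 10 :> R by lra.
have k1 : 1 <= k%:R :> R by rewrite ler1n.
rewrite /boundary_exponent ln_div ?posrE//.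
have h1 : 69 / 100 <= ln (2 * k%:R) :> R.
  by apply: (le_trans l2); rewrite ler_ln ?posrE//; lra.
have h2 : - (9 / 20) <= ln (69 / 100) :> R.
  have e : 100 / 69 * (69 / 100) = 1 :> R by field.
  have q : 0 < 69 / 100 :> R by lra.
  have q' : 0 < 100 / 69 :> R by lra.
  have : ln (1 + 31 / 69) <= 31 / 69 :> R by apply: le_ln1Dx; lra.
  rewrite (_ : 1 + 31 / 69 = 100 / 69); last by lra.
  rewrite -invf_div.
  by rewrite lnV ?posrE//; lra.
have : ln (69 / 100) <= ln (ln (2 * k%:R)) :> R.
  by rewrite ler_ln ?posrE; lra.
have := @ln52_lower_bound R; lra.
Qed.

Lemma boundary_exponent_gt0 k g : (0 < k)%N -> 0 < g < 1 -> 0 < boundary_exponent k g.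
Proof.
move=> k0 g01; have := boundary_exponent_ge _ _ k0 g01.
have : ln g <= 0 by case/andP: g01 => _ g1; rewrite ln_le0// ltW.
lra.
Qed.

Lemma Ccurv_gt0 k g : (0 < k)%N -> 0 < g < 1 -> 0 < Ccurv k g.
Proof.
move=> k0 g01; rewrite mulr_gt0 ?sqrtr_gt0 ?boundary_exponent_gt0//; lra.
Qed.

Lemma sqr_Ccurv k g : (0 < k)%N -> 0 < g < 1 ->
  Ccurv k g ^+ 2 = 289 / 100 * boundary_exponent k g.
Proof.
move=> k0 g01; have e0 := boundary_exponent_gt0 _ _ k0 g01.
by rewrite /Ccurv -/(boundary_exponent k g) exprMn sqr_sqrtr ?(ltW e0)//; field.
Qed.

(** Half the square of [Ccurv] has a coefficient 1.445 * 0.72 > 1 in front of [- ln g], and the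
    remaining constant is positive. *)
Lemma Ccurv_tail k g : (0 < k)%N -> 0 < g < 1 -> expR (- (Ccurv k g ^+ 2 / 2)) <= g.
Proof.
move=> k0 g01; rewrite sqr_Ccurv//.
have := boundary_exponent_ge _ _ k0 g01.
case/andP: g01 => g0 g1 H.
rewrite -[leRHS]lnK ?posrE// ler_expR.
have : ln g <= 0 by rewrite ln_le0// ltW.
lra.
Qed.

Lemma le_Ccurv (j k : nat) g : (0 < j <= k)%N -> 0 < g < 1 -> Ccurv j g <= Ccurv k g.
Proof.
move=> /andP[j0 jk] g01; have k0 := leq_trans j0 jk.
rewrite /Ccurv ler_pM2l; last by lra.
rewrite ler_wsqrtr// lerD2r.
have j1 : 1 <= j%:R :> R by rewrite ler1n.
have jk' : j%:R <= k%:R :> R by rewrite ler_nat.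
have l2 := @ln2_lower_bound R.
have h : ln 2 <= ln (2 * j%:R) :> R by rewrite ler_ln ?posrE//; lra.
have h' : ln (2 * j%:R) <= ln (2 * k%:R) :> R by rewrite ler_ln ?posrE//; lra.
by rewrite ler_ln ?posrE//; lra.
Qed.

(* The line through the epoch [2^j, 2^(j+1)) lying below the curve; the slope
   [83/100] is a rational stand-in for the optimal [2 (sqrt 2 - 1)]. *)
Definition epoch_slope g (j : nat) : R :=
  83 / 100 * Ccurv (2 ^ j) g / Num.sqrt (2 ^ j)%:R.

(** On the epoch the curve is at least [c * sqrt k], with [c] its constant at the left end.
    Rescaling by [t = sqrt (k / 2 ^ j)], which lies between 1 and [sqrt 2], leaves a quadratic
    inequality in [t]. *)
Lemma epoch_line_below_curve (j k : nat) g w : (2 ^ j <= k < 2 ^ j.+1)%N -> 0 < g < 1 ->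
  Ccurv k g * Num.sqrt k%:R <= w ->
  7 / 5 * epoch_exponent g j <= epoch_slope g j * w - epoch_slope g j ^+ 2 / 2 * k%:R.
Proof.
move=> /andP[jk kj] g01 Hw.
have j0 : (0 < 2 ^ j)%N by rewrite expn_gt0.
have c0 := Ccurv_gt0 _ _ j0 g01.
have cc := le_Ccurv (2 ^ j) k g _ g01; rewrite j0 jk in cc; have {}cc := cc isT.
have k0 := leq_trans j0 jk.
have E : epoch_exponent g j = boundary_exponent (2 ^ j) g.
  rewrite /epoch_exponent /boundary_exponent -natrM -expnS natrX lnXn//.
  by rewrite mulr_natl.
have sq := sqr_Ccurv _ _ j0 g01; rewrite -E in sq.
rewrite /epoch_slope; move: sq c0 cc; set c := Ccurv (2 ^ j) g => sq c0 cc.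
have Y0 : 0 < Num.sqrt (2 ^ j)%:R :> R by rewrite sqrtr_gt0 ltr0n.
have Y2 : Num.sqrt (2 ^ j)%:R ^+ 2 = (2 ^ j)%:R :> R by rewrite sqr_sqrtr.
have K0 : 0 < Num.sqrt k%:R :> R by rewrite sqrtr_gt0 ltr0n.
have K2 : Num.sqrt k%:R ^+ 2 = k%:R :> R by rewrite sqr_sqrtr.
have jk' : (2 ^ j)%:R <= k%:R :> R by rewrite ler_nat.
have kj' : k%:R <= 2 * (2 ^ j)%:R :> R by rewrite -natrM -expnS ler_nat ltnW.
move: Y0 Y2 K0 K2 Hw jk' kj'.
set Y := Num.sqrt (2 ^ j)%:R; set K := Num.sqrt k%:R => Y0 Y2 K0 K2 Hw jk' kj'.
pose t := K / Y; have KE : K = t * Y by rewrite /t divfK// gt_eqF.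
have t0 : 0 < t by rewrite divr_gt0.
have t1 : 1 <= t.
  rewrite -(@ler_pXn2r _ 2) ?nnegrE ?(ltW t0)// expr1n expr_div_n K2 Y2.
  by rewrite ler_pdivlMr ?mul1r// -Y2 exprn_gt0.
have t2 : t ^+ 2 <= 2.
  by rewrite expr_div_n K2 Y2 ler_pdivrMr// -Y2 exprn_gt0.
have t3 : t <= 1415 / 1000 by nra.
(* The right side is concave in [t], so the endpoints 1 and 1.415 decide; both values exceed 0.4847,
   and the left side is below 0.4845. *)
have poly : 7 / 5 / (289 / 100) <= 83 / 100 * t - (83 / 100) ^+ 2 / 2 * t ^+ 2 by nra.
have w1 : c * t * Y <= w.
  by apply: le_trans Hw; rewrite KE -mulrA ler_pM2r// mulr_gt0.
apply: (@le_trans _ _ (c ^+ 2 * (7 / 5 / (289 / 100)))).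
  by rewrite sq le_eqVlt; apply/orP; left; apply/eqP; field.
apply: (@le_trans _ _ (c ^+ 2 * (83 / 100 * t - (83 / 100) ^+ 2 / 2 * t ^+ 2))).
  by rewrite ler_pM2l// exprn_gt0.
rewrite (_ : c ^+ 2 * _ = 83 / 100 * c / Y * (c * t * Y) -
    (83 / 100 * c / Y) ^+ 2 / 2 * k%:R).
  by rewrite lerD2r ler_pM2l// divr_gt0// mulr_gt0//; lra.
by rewrite -K2 KE; field; rewrite gt_eqF.
Qed.

End curved_boundary.

(** * Law and crossing probabilities of the Gaussian walk *)

Section gaussian_walk_tails.
Context {d} {T : measurableType d} {R : realType}.
Local Notation RR := (measurableTypeR R).
Variables (P : probability T R) (n : nat) (X : nat -> {mfun T >-> RR}) (mu : nat -> R).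
Hypothesis X_indep : forall B : nat -> set RR, (forall i, measurable (B i)) ->
  P [set t | forall i, (i < n)%N -> B i (X i t)] =
  (\prod_(0 <= i < n) P (X i @^-1` B i))%E.
Hypothesis X_law : forall i (A : set RR), (i < n)%N -> measurable A ->
  P (X i @^-1` A) = normal_prob (mu i) 1 A.

Definition psum k (t : T) : RR := \sum_(0 <= i < k) X i t.

Definition psum_mean k : R := \sum_(0 <= i < k) mu i.

Lemma psum_indep k : (k <= n)%N -> indep_future P n X k (psum k).
Proof.
elim: k => [|k IH] kn.
  by rewrite (_ : psum 0 = cst 0);
    [exact: indep_future_cst|apply/funext => t; rewrite /psum big_geq].
have mh : measurable_fun setT (fun yz : RR * RR => yz.1 + yz.2 : RR).
  exact: measurable_funD.
have := indep_future_step P n X X_indep k _ _ kn mh (IH (ltnW kn)).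
by rewrite (_ : psum k.+1 = fun t => psum k t + X k t)//;
  apply/funext => t; rewrite /psum big_nat_recr.
Qed.

Lemma psum_law k (A : set RR) : (0 < k <= n)%N -> measurable A ->
  P (psum k @^-1` A) = normal_prob (psum_mean k) (Num.sqrt k%:R) A.
Proof.
(* The induction starts at [k = 1], because the convolution step needs a positive deviation. *)
case: k => // k /= ; elim: k A => [|k IH] A kn mA.
  rewrite (_ : psum 1 = X 0); last by apply/funext => t; rewrite /psum big_nat1.
  by rewrite X_law// /psum_mean big_nat1 sqrtr1.
have iS := psum_indep k.+1 (ltnW kn).
pose C : set (RR * RR) := [set yz | A (yz.1 + yz.2)].
have mh : measurable_fun setT (fun yz : RR * RR => yz.1 + yz.2 : RR).
  exact: measurable_funD.
have mC : measurable C by rewrite -[C]setTI; exact: mh.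
pose Y := to_mfun (psum k.+1) iS.1.
have := pair_law P n X X_indep k.+1 Y (fun _ => setT) C kn iS (fun _ => measurableT) mC.
rewrite (_ : future n X k.+2 _ = setT); last by apply/seteqP; split.
rewrite setIT probability_setT mule1.
rewrite (_ : _ @^-1` C = psum k.+2 @^-1` A); last first.
  by apply/seteqP; split=> t /=; rewrite /psum
    [in X in _ -> X]big_nat_recr//= ?[in X in X -> _]big_nat_recr.
move=> ->; rewrite /product_measure1.
rewrite (eq_measure_integral (normal_prob (psum_mean k.+1) (Num.sqrt k.+1%:R))); last first.
  by move=> D mD _; apply: IH => //; exact: ltnW.
transitivity (\int[normal_prob (psum_mean k.+1) (Num.sqrt k.+1%:R)]_y
    normal_prob (mu k.+1) 1 [set z | A (y + z)%R])%E.
  apply: eq_integral => y _ /=; rewrite /distribution /pushforward.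
  rewrite (_ : xsection C y = [set z | A (y + z)]); last first.
    by apply/seteqP; split=> z; rewrite /xsection /= inE.
  apply: X_law => //.
  rewrite -[X in measurable X]setTI.
  have ma : measurable_fun setT (fun z : RR => y + z : RR) by exact: measurable_funD.
  exact: ma.
have K0 : 0 < Num.sqrt k.+1%:R :> R by rewrite sqrtr_gt0.
have K2 : Num.sqrt k.+1%:R ^+ 2 + 1 = k.+2%:R :> R by rewrite sqr_sqrtr ?natr1.
have mS : psum_mean k.+2 = psum_mean k.+1 + mu k.+1 by rewrite /psum_mean big_nat_recr.
rewrite (normal_prob_conv _ _ _ _ K0 mA) K2 mS.
exact: erefl.
Qed.

Lemma measurable_psum_exists (D : set nat) (B : nat -> set RR) :
  (forall k, D k -> (k <= n)%N) -> (forall k, measurable (B k)) ->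
  measurable [set t | exists k, D k /\ B k (psum k t)].
Proof.
move=> Dn mB.
rewrite (_ : [set t | _] = \bigcup_(k in D) (psum k @^-1` B k)); last first.
  by apply/seteqP; split=> t /= [k]; [move=> [Dk H]; exists k|move=> Dk H; exists k].
apply: bigcup_measurable => k Dk; have [mS _] := psum_indep k (Dn k Dk).
by rewrite -[X in measurable X]setTI; exact: mS.
Qed.

(** The right side of the inequality is the logarithm of the unstopped exponential martingale at
    time [k]. *)
Definition line_event (lam a : R) := [set t | exists k, (k <= n)%N /\
  a <= lam * (psum k t - psum_mean k) - lam ^+ 2 / 2 * k%:R].

Lemma measurable_line_event lam a : measurable (line_event lam a).
Proof.
apply: (measurable_psum_exists [set k | (k <= n)%N] (fun k =>
  [set y | a <= lam * (y - psum_mean k) - lam ^+ 2 / 2 * k%:R])) => // k.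
have mf : measurable_fun setT
    (fun y : RR => lam * (y - psum_mean k) - lam ^+ 2 / 2 * k%:R : RR).
  by apply: measurable_funB => //; apply: measurable_funM => //; apply: measurable_funB.
rewrite (_ : [set y | _] = (fun y : RR => lam * (y - psum_mean k) - lam ^+ 2 / 2 * k%:R : RR)
   @^-1` `[a, +oo[%classic); last first.
  by apply/seteqP; split => x /=; rewrite in_itv/= andbT.
by rewrite -[X in measurable X]setTI; exact: mf.
Qed.

Lemma prob_line_event (lam a : R) : (P (line_event lam a) <= (expR (- a))%:E)%E.
Proof.
have := stopped_exp_tail P n X mu X_indep X_law lam (expR a) (expR_gt0 a).
rewrite expRN; apply: le_trans; apply: le_measure; rewrite ?inE.
- exact: measurable_line_event.
- exact: (measurable_stopped_exp_ge P n X mu X_indep).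
- move=> t [k [kn ak]]; apply: (stopped_exp_stays X mu lam (expR a) k n) => //.
  have [//|->] := stopped_exp_reached X mu lam (expR a) k t.
  rewrite ler_expR (le_trans ak)// big_split/= sumrN sumr_const_nat subn0.
  rewrite -mulr_sumr sumrB -(mulr_natr (lam ^+ 2 / 2) k). exact: lexx.
Qed.

Lemma psum_gt_prob k (x : R) : (0 < k <= n)%N ->
  P [set t | x < psum k t] = (1 - Phi ((x - psum_mean k) / Num.sqrt k%:R))%:E.
Proof.
move=> kn; have k0 : 0 < Num.sqrt k%:R :> R.
  by rewrite sqrtr_gt0 ltr0n; case/andP: kn.
rewrite -normal_prob_itvoy.
have -> : [set t | x < psum k t] = psum k @^-1` `]x, +oo[%classic.
  by apply/seteqP; split => t /=; rewrite in_itv/= andbT.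
rewrite psum_law//.
have := normal_prob_affine 0 1 (Num.sqrt k%:R) (psum_mean k) `]x, +oo[%classic
  (oner_neq0 _) k0 (measurable_itv _).
rewrite mulr0 add0r mulr1 => <-; congr normal_prob.
by apply/seteqP; split => y /=; rewrite !in_itv/= !andbT -ltrBlDr ltr_pdivrMr// mulrC.
Qed.

Lemma measurable_psum_lt k (x : R) : (k <= n)%N ->
  measurable [set t | psum k t - psum_mean k < x].
Proof.
move=> kn; have [mS _] := psum_indep k kn.
rewrite (_ : [set t | _] = psum k @^-1` `]-oo, x + psum_mean k[%classic).
  by rewrite -[X in measurable X]setTI; exact: mS.
by apply/seteqP; split => t /=; rewrite in_itv/= ltrBlDr.
Qed.

Lemma psum_lt_curve_prob k g : (0 < k <= n)%N -> 0 < g < 1 ->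
  (P [set t | psum k t - psum_mean k < - (Ccurv k g * Num.sqrt k%:R)]%R <= g%:E)%E.
Proof.
move=> /andP[k0 kn] g01.
(* The Chernoff choice of slope: at [- C * sqrt k] the line expression equals
   [C ^+ 2 - C ^+ 2 / 2]. *)
apply: (@le_trans _ _ (P (line_event (- (Ccurv k g / Num.sqrt k%:R)) (Ccurv k g ^+ 2 / 2)))).
  apply: le_measure; rewrite ?inE; last 2 first.
  - exact: measurable_line_event.
  - move=> t /= H; exists k; split=> //.
    have K0 : 0 < Num.sqrt k%:R :> R by rewrite sqrtr_gt0 ltr0n.
    have K2 : Num.sqrt k%:R ^+ 2 = k%:R :> R by rewrite sqr_sqrtr.
    move: H K0 K2; have := Ccurv_gt0 _ _ k0 g01.
    set c := Ccurv k g; set K := Num.sqrt k%:R; set w := _ - _ => c0 H K0 <-.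
    rewrite (_ : - (c / K) * w - (- (c / K)) ^+ 2 / 2 * K ^+ 2 = c / K * - w - c ^+ 2 / 2).
      rewrite lerBrDr (_ : c ^+ 2 / 2 + c ^+ 2 / 2 = c / K * (c * K)).
        by rewrite ler_pM2l ?divr_gt0// lerNr ltW.
      by field; rewrite gt_eqF.
    by field; rewrite gt_eqF.
  - exact: measurable_psum_lt.
apply: le_trans (prob_line_event _ _) _.
by rewrite lee_fin Ccurv_tail.
Qed.

Lemma measurable_curve_crossing (f : nat -> R) :
  measurable [set t | exists k, (0 < k <= n)%N /\ f k <= psum k t - psum_mean k].
Proof.
rewrite (_ : [set t | _] = [set t | exists k, (0 < k <= n)%N /\
    `[f k + psum_mean k, +oo[%classic (psum k t)]); last first.
  by apply/seteqP; split => t /= [k [kn H]]; exists k; split => //;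
    move: H; rewrite /= in_itv/= andbT lerBrDr.
apply: (measurable_psum_exists [set k | (0 < k <= n)%N]
  (fun k => `[f k + psum_mean k, +oo[%classic)) => // k.
by move=> /andP[].
Qed.

Lemma psum_curve_crossing_prob g : (0 < n)%N -> 0 < g < 1 ->
  (P [set t | exists k, (0 < k <= n)%N /\
     (Ccurv k g * Num.sqrt k%:R <= psum k t - psum_mean k)%R] < g%:E)%E.
Proof.
move=> n0 g01.
(* A union bound over epochs; [n] of them suffice, since [2 ^ j <= k <= n] forces [j < n]. *)
apply: (@le_lt_trans _ _ (P (\big[setU/set0]_(j < n)
    line_event (epoch_slope g j) (7 / 5 * epoch_exponent g j)))).
  apply: le_measure; rewrite ?inE.
  - exact: measurable_curve_crossing.
  - by apply: bigsetU_measurable => j _; exact: measurable_line_event.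
  - move=> t [k [/andP[k0 kn] H]].
    have jk := trunc_log_bounds (isT : (1 < 2)%N) k0.
    have jn : (trunc_log 2 k < n)%N.
      by apply: leq_trans kn; case/andP: jk => jk _; apply: leq_trans jk; exact: ltn_expl.
    rewrite -(bigcup_mkord n (fun j => line_event (epoch_slope g j) (7 / 5 * epoch_exponent g j))).
    exists (trunc_log 2 k) => //.
    by exists k; split=> //; exact: epoch_line_below_curve.
have mE j : measurable (line_event (epoch_slope g j) (7 / 5 * epoch_exponent g j)).
  exact: measurable_line_event.
apply: (le_lt_trans (@Boole_inequality _ _ _ P
  (fun j => line_event (epoch_slope g j) (7 / 5 * epoch_exponent g j)) n (fun j _ => mE j))).
apply: (@le_lt_trans _ _ (\sum_(j < n) (expR (- (7 / 5 * epoch_exponent g j)))%:E)%E).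
  by apply: lee_sum => j _; exact: prob_line_event.
rewrite sumEFin lte_fin.
by rewrite -(big_mkord xpredT (fun j => expR (- (7 / 5 * epoch_exponent g j)))) epoch_sum_lt.
Qed.

End gaussian_walk_tails.

(** * The power of the two tests *)

Lemma Phi_NZq {R : realType} (g : R) : 0 < g < 1 -> Phi (- Zq g) = g.
Proof.
move=> /andP[g0 g1]; rewrite PhiN /Zq Phi_invK ?subKr//.
by rewrite subr_gt0 g1 gtrBl.
Qed.

Theorem theorem4 (R : realType) (d : measure_display) (T : measurableType d)
  (P : probability T R) (n : nat) (hn : (0 < n)%N)
  (Z : 'I_n -> {RV P >-> R}) (mu : 'I_n -> R)
  (hmu : forall i, 0 <= mu i)
  (hind : mutually_independent Z)
  (hlaw : forall i (A : set R), measurable A ->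
            distribution P (Z i) A = normal_prob (mu i) 1 A)
  (alpha beta : R) (ha : 0 < alpha < 1) (hb : 0 < beta < 1) :
  let r i : R := if 0 < mu i then 1 else 0 in
  let p i t : R := 1 - Phi (Z i t) in
  let S (k : nat) t : R := \sum_(i < n | (i < k)%N) Phi_inv (1 - p i t) in
  let batch := [set t | Num.sqrt n%:R * Zq alpha < S n t] in
  let mart := [set t | exists k : nat,
                  [/\ (1 <= k)%N, (k <= n)%N & Ccurv k alpha * Num.sqrt k%:R <= S k t]] in
  let M (k : nat) : R := \sum_(i < n | (i < k)%N) r i * mu i in
  [/\ ((1 - beta)%:E <= P batch)%E <->
        (Zq alpha + Zq beta) * Num.sqrt n%:R <= M n,
      (exists k : nat, [/\ (1 <= k)%N, (k <= n)%N &
          (Ccurv k alpha + Ccurv k beta) * Num.sqrt k%:R <= M k]) ->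
        ((1 - beta)%:E <= P mart)%E
    & alpha < 1 - beta ->
      (forall k : nat, (1 <= k)%N -> (k <= n)%N ->
          M k <= (Ccurv k alpha - Ccurv k (1 - beta)) * Num.sqrt k%:R) ->
      (P mart < (1 - beta)%:E)%E].
Proof.
(* The family is extended by zero beyond [n] to be indexed by naturals; the walk lemmas constrain
   only indices below [n]. *)
pose X (i : nat) : {mfun T >-> measurableTypeR R} :=
  if insub i is Some j then to_mfun (Z j) (measurable_funPT (Z j)) else cst 0.
pose m (i : nat) : R := if insub i is Some j then mu j else 0.
have XE (i : 'I_n) t : X i t = Z i t by rewrite /X valK.
have mE (i : 'I_n) : m i = mu i by rewrite /m valK.
have X_indep (B : nat -> set (measurableTypeR R)) : (forall i, measurable (B i)) ->
    P [set t | forall i, (i < n)%N -> B i (X i t)] =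
    (\prod_(0 <= i < n) P (X i @^-1` B i))%E.
  move=> mB; rewrite big_mkord.
  have := hind [set: 'I_n]%SET (fun i => B i) (fun i => mB i).
  rewrite (_ : [set t | forall i : 'I_n, _] =
    [set t | forall i, (i < n)%N -> B i (X i t)]); last first.
    apply/seteqP; split => t /= H i => [i_n|_].
      by have := H (Ordinal i_n); rewrite inE -XE; apply.
    by rewrite -XE; exact: H.
  move=> ->; apply: eq_big => i; first by rewrite inE.
  by move=> _; congr (P _); apply/seteqP; split => t; rewrite /= XE.
have X_law i (A : set (measurableTypeR R)) : (i < n)%N -> measurable A ->
    P (X i @^-1` A) = normal_prob (m i) 1 A.
  move=> i_n mA; rewrite (mE (Ordinal i_n)) -hlaw//; congr (P _).
  by apply/seteqP; split => t; rewrite /= -(XE (Ordinal i_n)).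
move=> r p S batch mart M.
have SE k t : (k <= n)%N -> S k t = psum X k t.
  move=> kn; rewrite /psum big_mkord (big_ord_widen n (fun i => X i t) kn).
  apply: eq_bigr => i _; rewrite /p subKr PhiK; exact/esym/XE.
have ME k : (k <= n)%N -> M k = psum_mean m k.
  move=> kn; rewrite /psum_mean big_mkord (big_ord_widen n m kn).
  apply: eq_bigr => i _; rewrite mE /r; case: ltgtP (hmu i) => // [_|<-] _.
    by rewrite mul1r.
  by rewrite mulr0.
have martE : mart = [set t | exists k, (0 < k <= n)%N /\
    `[Ccurv k alpha * Num.sqrt k%:R, +oo[%classic (psum X k t)].
  apply/seteqP; split => t /= [k].
    move=> [k0 kn H]; exists k; split; first by rewrite k0.
    by rewrite /= in_itv/= andbT -SE.
  move=> [/andP[k0 kn]]; rewrite /= in_itv/= andbT => H; exists k; split => //.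
  by rewrite SE.
have mmart : measurable mart.
  rewrite martE; apply: (measurable_psum_exists P n X X_indep
    [set k | (0 < k <= n)%N] (fun k => `[Ccurv k alpha * Num.sqrt k%:R, +oo[%classic)) => // k.
  by case/andP.
have hb' : 0 < 1 - beta < 1 by case/andP: hb => b0 b1; rewrite subr_gt0 b1 gtrBl.
split.
- have -> : batch = [set t | Num.sqrt n%:R * Zq alpha < psum X n t].
    by apply/seteqP; split => t; rewrite /batch /mkset (SE n t (leqnn n)).
  have sn0 : 0 < Num.sqrt n%:R :> R by rewrite sqrtr_gt0 ltr0n.
  rewrite (psum_gt_prob P n X m X_indep X_law) ?hn ?leqnn// ME//.
  (* The power condition says that [Phi] of the standardised threshold is at most [beta]; writing
     [beta] as [Phi (- Zq beta)] and using monotonicity compares the arguments. *)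
  rewrite lee_fin lerD2l lerN2 -[leRHS](Phi_NZq _ hb) leNgt Phi_lt -leNgt.
  rewrite ler_pdivrMr// mulNr mulrDl.
  split => H; lra.
(* Failure to reject leaves the sum at this [k] below the [alpha] curve, so the centred sum falls
   below minus the [beta] curve. *)
- move=> [k [k0 kn Hk]]; have k0n : (0 < k <= n)%N by rewrite k0.
  have H := psum_lt_curve_prob P n X m X_indep X_law k beta k0n hb.
  rewrite -(setCK mart) probability_setC; last exact: measurableC.
  rewrite EFinB leeB// (le_trans _ H)//; apply: le_measure; rewrite ?inE.
  + exact: measurableC.
  + exact: (measurable_psum_lt P n X m X_indep).
  + move=> t nmart /=; rewrite ltNge; apply/negP => Hc; apply: nmart.
    by exists k; split => //; rewrite SE//; move: Hk Hc; rewrite ME// mulrDl; lra.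
(* Rejection at any [k] forces the centred walk above the curve of level [1 - beta]. *)
- move=> _ HM; apply: le_lt_trans (psum_curve_crossing_prob P n X m X_indep X_law _ hn hb').
  apply: le_measure; rewrite ?inE//.
    exact: (measurable_curve_crossing P n X m X_indep
      (fun k => Ccurv k (1 - beta) * Num.sqrt k%:R)).
  move=> t [k [k0 kn Hk]]; exists k; split; first by rewrite k0.
  by move: Hk (HM k k0 kn); rewrite SE// ME// mulrBl; lra.
Qed.
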